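(* Let $\epsilon,\mu>0$ be constants. Let $F_0=\sqrt\epsilon\,\mathbf{E}_0+i\sqrt\mu\,\mathbf{H}_0:\mathbb{R}^3\to\mathbb{C}^3$ ($\mathbf{E}_0,\mathbf{H}_0$ real-valued) be periodic and expressed by its Fourier series $F_0(\mathbf{x})=f_0+\sum_{\mathbf{w}\ne0}\mathbf{a}_{\mathbf{w}}e^{i\mathbf{x}\cdot\mathbf{w}}$ with $f_0,\mathbf{a}_{\mathbf{w}}\in\mathbb{C}^3$ and $\sum_{\mathbf{w}\ne0}|\mathbf{w}||\mathbf{a}_{\mathbf{w}}|<\infty$. Let $(\alpha_{1,\mathbf{w}},\alpha_{2,\mathbf{w}},\alpha_{3,\mathbf{w}})^T=V_{\mathbf{w}}^\dagger\mathbf{a}_{\mathbf{w}}$ and let $\mathbf{E},\mathbf{H}$ be the real-valued fields determined by $$\sqrt\epsilon\,\mathbf{E}(\mathbf{x},t)+i\sqrt\mu\,\mathbf{H}(\mathbf{x},t)=f_0+\sum_{\mathbf{w}\neq0}\sum_{1\le d\le3}e^{\frac{-it\mu_{d,\mathbf{w}}}{\sqrt{\mu\epsilon}}}\,\alpha_{d,\mathbf{w}}\mathbf{v}_{d,\mathbf{w}}e^{i\mathbf{x}\cdot\mathbf{w}},$$ i.e. the solution of Maxwell's equations $\partial_t\mathbf{H}=-\frac1\mu\mathrm{curl}\,\mathbf{E}$, $\partial_t\mathbf{E}=\frac1\epsilon\mathrm{curl}\,\mathbf{H}$ with initial data $\mathbf{E}_0,\mathbf{H}_0$. Then $\mathbf{E}$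 and $\mathbf{H}$ keep the conservation of divergence: $$\nabla\cdot(\mathbf{E}-\mathbf{E}_0)=0,\qquad \nabla\cdot(\mathbf{H}-\mathbf{H}_0)=0.$$
   Context: The sums run over the nonzero wave vectors $\mathbf{w}\in\mathbb{R}^3$ occurring in the Fourier series of the periodic function $F_0$ (nonzero elements of the lattice dual to its period lattice). Divergence and curl act in $\mathbf{x}\in\mathbb{R}^3$. For $\mathbf{w}=(w_1,w_2,w_3)^T\in\mathbb{R}^3\setminus\{0\}$ put $s_{\mathbf{w}}=w_1+w_2+w_3$, $\mathbf{r}_{\mathbf{w}}=(w_2-w_3,w_3-w_1,w_1-w_2)^T$, $\nu_{\mathbf{w}}=\sqrt2\,|\mathbf{r}_{\mathbf{w}}|/|\mathbf{w}|$, and $\mu_{1,\mathbf{w}}=0$, $\mu_{2,\mathbf{w}}=-|\mathbf{w}|$, $\mu_{3,\mathbf{w}}=|\mathbf{w}|$ (not to be confused with the constant $\mu$). Put $\mathbf{v}_{1,\mathbf{w}}=\mathbf{w}/|\mathbf{w}|$. If $\mathbf{r}_{\mathbf{w}}\neq0$, put for $d=2,3$ $$\mathbf{v}_{d,\mathbf{w}}=\frac{1}{\nu_{\mathbf{w}}}\left(\frac{s_{\mathbf{w}}}{|\mathbf{w}|^2}\mathbf{w}-(1,1,1)^T-i\frac{\mu_{d,\mathbf{w}}}{|\mathbf{w}|^2}\mathbf{r}_{\mathbf{w}}\right).$$ If $\mathbf{r}_{\mathbf{w}}=0$, i.e. $w_1=w_2=w_3=\omega$, let $v_2=\frac{1}{\sqrt3}\left(\frac{1+i\sqrt3}{2},\frac{1-i\sqrt3}{2},-1\right)^T$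 and put $\mathbf{v}_{2,\mathbf{w}}=v_2$ if $\omega\ge0$, $\mathbf{v}_{2,\mathbf{w}}=\overline{v_2}$ if $\omega<0$, and $\mathbf{v}_{3,\mathbf{w}}=\overline{\mathbf{v}_{2,\mathbf{w}}}$. $V_{\mathbf{w}}$ is the matrix with columns $\mathbf{v}_{1,\mathbf{w}},\mathbf{v}_{2,\mathbf{w}},\mathbf{v}_{3,\mathbf{w}}$ and $V_{\mathbf{w}}^\dagger$ its conjugate transpose. *)

(* Defs.v *)
From HB Require Import structures.
From mathcomp Require Import all_boot all_order all_algebra.
From mathcomp Require Import complex.
From mathcomp Require Import all_classical all_reals all_analysis.
From mathcomp.analysis.showcase Require summability.
Import Order.TTheory GRing.Theory Num.Theory.
Import numFieldNormedType.Exports.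

Set Implicit Arguments.
Unset Strict Implicit.
Unset Printing Implicit Defensive.

Local Open Scope classical_set_scope.
Local Open Scope ring_scope.
Local Open Scope sesquilinear_scope.

Section Definitions.
Variable R : realType.
Implicit Types (w x : 'cV[R]_3) (P : 'M[R]_3) (eps mu : R).

Definition dot x w : R := (x^T *m w) 0 0.

(* The library norm on matrices is the sup norm, so the Euclidean norms on
   R^3 and C^3 are spelled out. *)
Definition enorm w : R := Num.sqrt (dot w w).
Definition cnorm (a : 'cV[R[i]]_3) : R :=
  Num.sqrt (\sum_i (complex.Re (a i 0) ^+ 2 + complex.Im (a i 0) ^+ 2)).

Definition expi (theta : R) : R[i] := (cos theta +i* sin theta)%C.

Definition cvec (u : 'cV[R]_3) : 'cV[R[i]]_3 := map_mx (real_complex R) u.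

(* The unordered sum over D: the limit of the finite partial sums along the
   net of finite subsets, taken on the real and imaginary parts of the three
   coordinates. *)
Definition rsum (D : set 'cV[R]_3) (f : 'cV[R]_3 -> R) : R :=
  summability.sum (patch (fun=> 0) D f).
Definition vsum (D : set 'cV[R]_3) (f : 'cV[R]_3 -> 'cV[R[i]]_3) :
    'cV[R[i]]_3 :=
  \col_i (rsum D (fun w => complex.Re (f w i 0))
          +i* rsum D (fun w => complex.Im (f w i 0)))%C.

(* The period lattice consists of the integer combinations of the columns of
   the invertible matrix P; its dual is normalized so that e^{i x . w} is
   P-periodic in x. *)
Definition period P (k : 'cV[int]_3) : 'cV[R]_3 := P *m map_mx intr k.
Definition wave_vectors P : set 'cV[R]_3 :=
  [set w | w != 0 /\
     forall k : 'cV[int]_3, exists m : int, dot (period P k) w = 2 * pi * m%:~R].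

Definition svec w : R := \sum_i w i 0.
Definition rvec w : 'cV[R]_3 :=
  \col_i [tuple w 1 0 - w 2 0; w 2 0 - w 0 0; w 0 0 - w 1 0]`_i.
Definition nu w : R := Num.sqrt 2 * enorm (rvec w) / enorm w.

(* The indices d = 1, 2, 3 are represented by 0, 1, 2 : 'I_3. *)
Definition mud (d : 'I_3) w : R := [tuple 0; - enorm w; enorm w]`_d.

(* The vector v_2 used when w_1 = w_2 = w_3. *)
Definition v2diag : 'cV[R[i]]_3 :=
  ((Num.sqrt 3)^-1)%:C%C *:
  \col_i [tuple (1 / 2 +i* (Num.sqrt 3 / 2))%C;
                (1 / 2 -i* (Num.sqrt 3 / 2))%C; -1]`_i.

Definition vd (d : 'I_3) w : 'cV[R[i]]_3 :=
  if d == 0 then cvec ((enorm w)^-1 *: w)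
  else if rvec w != 0 then
    ((nu w)^-1)%:C%C *:
      (cvec ((svec w / enorm w ^+ 2) *: w - const_mx 1)
       - ('i * (mud d w / enorm w ^+ 2)%:C)%C *: cvec (rvec w))
  else
    let v2 := if 0 <= w 0 0 then v2diag else map_mx Num.conj v2diag in
    if d == 1 then v2 else map_mx Num.conj v2.

Definition Vmx w : 'M[R[i]]_3 := \matrix_(i, d) vd d w i 0.

Definition alpha (a : 'cV[R]_3 -> 'cV[R[i]]_3) (d : 'I_3) w : R[i] :=
  ((Vmx w)^t* *m a w) d 0.

Definition em_vector eps mu (E H : 'cV[R]_3) : 'cV[R[i]]_3 :=
  cvec (Num.sqrt eps *: E) + 'i%C *: cvec (Num.sqrt mu *: H).

(* 'D_v takes a junk value where the derivative does not exist, so that div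
   is meaningful only where has_div holds. *)
Definition has_div (G : 'cV[R]_3 -> 'cV[R]_3) x : Prop :=
  forall i : 'I_3, derivable (fun y => G y i 0) x (delta_mx i 0).
Definition div (G : 'cV[R]_3 -> 'cV[R]_3) x : R :=
  \sum_(i < 3) 'D_(delta_mx i 0) (fun y => G y i 0) x.

End Definitions.

(* Main.v *)
(** In the difference of the two series, the coefficient of e^{i x . w} is
    b_w = sum_d (e^{-i t mu_d / sqrt (mu eps)} - 1) alpha_d v_d, because V_w is
    unitary and so sum_d alpha_d v_d = a_w.  The term d = 1 vanishes since
    mu_1 = 0, and v_2, v_3 are orthogonal to v_1 = w / |w|; hence w . b_w = 0,
    i.e. each mode of the difference is divergence free.  The entries of V_w are
    bounded, so |b_w| <= C |a_w|, and the difference quotients of the modes are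
    dominated by the summable family |w| |a_w|: the series can be differentiated
    term by term.  The series themselves converge absolutely because the nonzero
    vectors of the dual lattice are bounded away from 0. *)

Require Import Defs.
From HB Require Import structures.
From mathcomp Require Import all_boot all_order all_algebra.
From mathcomp Require Import complex finmap.
From mathcomp Require Import all_classical all_reals all_analysis.
From mathcomp.analysis.showcase Require summability.
From mathcomp Require Import ring lra.
Import Order.TTheory GRing.Theory Num.Theory.
Import numFieldNormedType.Exports.

Set Implicit Arguments.
Unset Strict Implicit.
Unset Printing Implicit Defensive.

Local Open Scope classical_set_scope.
Local Open Scope ring_scope.
Local Open Scope sesquilinear_scope.

Import summability (partial_sum, totally, totally_filter).
#[local] Existing Instance totally_filter.

(** * Unordered sums dominated by a summable family *)

Lemma cvg_sumr (R : realType) (J T : Type) (F : set_system T) {FF : Filter F}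
    (s : seq J) (f : J -> T -> R) (l : J -> R) :
  (forall j, f j @ F --> l j) ->
  (fun x => \sum_(j <- s) f j x) @ F --> \sum_(j <- s) l j.
Proof. by move=> fl; apply: cvg_big => //; exact: add_continuous. Qed.

Section dominated_sums.
Variables (R : realType) (I : choiceType).
Implicit Types (f g : I -> R) (A B : {fset I}).

(** For nonnegative [g] this is summability; the supremum of the partial sums then plays the role of
    the total. *)
Definition bounded_sums g := has_ubound (range (partial_sum g)).

Lemma partial_sumE f A : partial_sum f A = \sum_(i <- A) f i.
Proof. by rewrite /partial_sum big_seq_fsetE. Qed.

Lemma bounded_sumsZ (k : R) g : 0 <= k ->
  bounded_sums g -> bounded_sums (fun i => k * g i).
Proof.
move=> k0 [M Mg]; exists (k * M) => _ [A _ <-].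
rewrite partial_sumE -mulr_sumr ler_wpM2l// -partial_sumE.
by apply: Mg; exists A.
Qed.

(** The difference is the sum of [f] over [B] minus [A], dominated there by [g], and outside [A] at
    most [e] of the supremum for [g] is left. *)
Lemma dominated_tail f g A B (e : R) : (forall i, `|f i| <= g i) ->
  bounded_sums g -> (A `<=` B)%fset ->
  sup (range (partial_sum g)) - e < partial_sum g A ->
  `|partial_sum f B - partial_sum f A| <= e.
Proof.
move=> fg ubg AB gA.
have gB : partial_sum g B <= sup (range (partial_sum g)).
  by apply: ub_le_sup => //; exists B.
have split_sum (h : I -> R) : partial_sum h B - partial_sum h A = partial_sum h (B `\` A)%fset.
  rewrite !partial_sumE (big_fsetID _ (mem A)) /=.
  have -> : [fset x in B | x \in A]%fset = A.
    by apply/fsetP => i; rewrite !inE /=; apply: andb_idl => /(fsubsetP AB).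
  rewrite addrAC subrr add0r; apply: eq_fbigl => i.
  by rewrite !inE /= andbC.
rewrite split_sum partial_sumE.
rewrite (le_trans (ler_norm_sum _ _ _))// (le_trans (ler_sum _ (fun i _ => fg i)))//.
by rewrite -partial_sumE -split_sum; lra.
Qed.

Lemma bounded_sums_adherent g (e : R) : bounded_sums g -> 0 < e ->
  exists A, sup (range (partial_sum g)) - e < partial_sum g A.
Proof.
move=> ubg e0; have [|_ [A _ <-] gA] := @sup_adherent _ _ e e0 (conj _ ubg).
  by exists (partial_sum g fset0), fset0.
by exists A.
Qed.

(** By the tail bound the net of partial sums is Cauchy, and [R] is complete. *)
Lemma dominated_sum_cvg f g : (forall i, `|f i| <= g i) -> bounded_sums g ->
  partial_sum f @ totally --> summability.sum f.
Proof.
move=> fg ubg; apply/cauchy_cvgP/cauchy_exP => e e0.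
(* Half of [e] turns the non-strict tail bound into the strict inequality of a ball. *)
have [A gA] := bounded_sums_adherent ubg (divr_gt0 e0 (ltr0n _ 2)).
exists (partial_sum f A), A => // B /= AB.
rewrite /ball /= distrC (le_lt_trans (dominated_tail fg ubg AB gA))//; lra.
Qed.

(** The tail bound is uniform in [B] containing [A], hence survives the limit in [B]. *)
Lemma dominated_sum_dist f g A (e : R) : (forall i, `|f i| <= g i) ->
  bounded_sums g -> sup (range (partial_sum g)) - e < partial_sum g A ->
  `|summability.sum f - partial_sum f A| <= e.
Proof.
move=> fg ubg gA.
have cf : (fun B => `|partial_sum f B - partial_sum f A|) @ totally -->
    `|summability.sum f - partial_sum f A|.
  apply: cvg_norm; apply: cvgB; last exact: cvg_cst.
  exact: dominated_sum_cvg fg ubg.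
rewrite -(cvg_lim _ cf)//; apply: limr_le; first by apply/cvg_ex; eexists; exact: cf.
by exists A => // B /= AB; exact: dominated_tail fg ubg AB gA.
Qed.

Lemma dominated_sumB f1 f2 g1 g2 :
  (forall i, `|f1 i| <= g1 i) -> bounded_sums g1 ->
  (forall i, `|f2 i| <= g2 i) -> bounded_sums g2 ->
  summability.sum (fun i => f1 i - f2 i) =
  summability.sum f1 - summability.sum f2.
Proof.
move=> fg1 u1 fg2 u2; apply: cvg_lim => //.
rewrite (_ : partial_sum _ = fun A => partial_sum f1 A - partial_sum f2 A).
  by apply: cvgB; [exact: dominated_sum_cvg fg1 u1|exact: dominated_sum_cvg fg2 u2].
by apply/funext => A; rewrite !partial_sumE sumrB.
Qed.

Lemma dominated_sum_sum (J : finType) (f g : J -> I -> R) :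
  (forall j i, `|f j i| <= g j i) -> (forall j, bounded_sums (g j)) ->
  \sum_j summability.sum (f j) = summability.sum (fun i => \sum_j f j i).
Proof.
move=> fg ub; apply/esym/cvg_lim => //.
rewrite (_ : partial_sum _ = fun A => \sum_j partial_sum (f j) A).
  by apply: cvg_sumr => j; exact: dominated_sum_cvg (fg j) (ub j).
apply/funext => A; rewrite partial_sumE exchange_big.
by apply: eq_bigr => j _; rewrite partial_sumE.
Qed.

(* Dominated convergence for unordered sums (Tannery): off a finite set carrying
   all but [e] of [g], every sum dominated by [g] is at most [e]. *)
Lemma dominated_cvg_sum (T : Type) (F : set_system T) {FF : Filter F}
    (q : T -> I -> R) (l g : I -> R) :
  bounded_sums g ->
  (\forall h \near F, forall i, `|q h i| <= g i) -> (forall i, `|l i| <= g i) ->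
  (forall i, q ^~ i @ F --> l i) ->
  (fun h => summability.sum (q h)) @ F --> summability.sum l.
Proof.
move=> ubg qg lg ql; apply/cvgrPdist_le => e e0.
(* One third each for the tail of [l], the tail of [q h] and the finite sum over [A]. *)
have e3 : 0 < e / 3 by rewrite divr_gt0.
have [A gA] := bounded_sums_adherent ubg e3.
have qA : (fun h => partial_sum (q h) A) @ F --> partial_sum l A.
  rewrite partial_sumE; under eq_fun do rewrite partial_sumE.
  by apply: cvg_sumr => i; exact: ql.
have lA := dominated_sum_dist lg ubg gA.
near=> h.
have qh : forall i, `|q h i| <= g i by near: h.
have qhA := dominated_sum_dist qh ubg gA.
have : `|partial_sum l A - partial_sum (q h) A| <= e / 3.
  by near: h; exact: (cvgrPdist_le _ _).1 qA _ e3.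
move: lA qhA; rewrite !ler_norml => /andP[? ?] /andP[? ?] /andP[? ?].
by apply/andP; split; lra.
Unshelve. all: by end_near. Qed.

(** [g0] makes the sums converge, and [g] dominates the difference quotients at 0, so dominated
    convergence applies to them as [h] tends to 0. *)
Lemma is_derive_sum (u : I -> R -> R) (du g0 g : I -> R) :
  bounded_sums g0 -> bounded_sums g ->
  (forall i h, `|u i h| <= g0 i) ->
  (forall i h, `|u i h - u i 0| <= `|h| * g i) ->
  (forall i, is_derive (0 : R) (1 : R) (u i) (du i)) ->
  is_derive (0 : R) (1 : R) (fun h => summability.sum (u ^~ h))
    (summability.sum du).
Proof.
move=> ub0 ub ug0 ug uder.
have cvq i : (fun h => h^-1 *: (u i (h *: 1 + 0) - u i 0)) @ 0^' --> du i.
  by have [d <-] := uder i.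
have qg (h : R) i : h != 0 -> `|h^-1 *: (u i (h *: 1 + 0) - u i 0)| <= g i.
  move=> h0; rewrite normrZ normfV ler_pdivrMl ?normr_gt0// addr0 [_%:A]mulr1.
  exact: ug.
(* The derivatives inherit the bound on the quotients, as dominated convergence asks of the limit
   family. *)
have dug i : `|du i| <= g i.
  have cn : `|h^-1 *: (u i (h *: 1 + 0) - u i 0)| @[h --> 0^'] --> `|du i|.
    by apply: cvg_norm; exact: cvq.
  rewrite -(cvg_lim _ cn)//; apply: limr_le; first by apply/cvg_ex; eexists; exact: cn.
  by near=> h; apply: qg; near: h; exact: nbhs_dnbhs_neq.
suff cS : (fun h => h^-1 *: ((fun h => summability.sum (u ^~ h)) (h *: 1 + 0) -
      summability.sum (u ^~ 0))) @ 0^' --> summability.sum du.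
  split; first by apply/cvg_ex; eexists; exact: cS.
  exact: cvg_lim cS.
rewrite (_ : (fun h => _) = fun h : R => summability.sum
    (fun i => h^-1 *: (u i (h *: 1 + 0) - u i 0))).
  apply: (@dominated_cvg_sum _ _ _ _ _ g) => //.
  by near=> h => i; apply: qg; near: h; exact: nbhs_dnbhs_neq.
apply/funext => h /=.
(* Both sums converge under [g0], so the quotient of the sums is the sum of the quotients. *)
rewrite -(dominated_sumB (ug0 ^~ _) ub0 (ug0 ^~ _) ub0).
apply/esym/cvg_lim => //.
rewrite (_ : partial_sum _ =
    fun A => h^-1 *: partial_sum (fun i => u i (h *: 1 + 0) - u i 0) A).
  apply: cvgZl_tmp; apply: (@dominated_sum_cvg _ (fun i => g0 i + g0 i)).
    by move=> i; rewrite (le_trans (ler_normB _ _))// lerD.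
  case: ub0 => M gM; exists (M + M) => _ [A _ <-].
  by rewrite partial_sumE big_split /= -!partial_sumE lerD// gM//; exists A.
by apply/funext => A; rewrite !partial_sumE -scaler_sumr.
Unshelve. all: by end_near. Qed.

End dominated_sums.

(** * Termwise divergence of a series of plane waves *)

Section waves.
Variable R : realType.
Implicit Types (x y w : 'cV[R]_3) (c : R[i]) (theta kappa h : R).

(** The directional difference quotient at [x] and the quotient at 0 of the restriction to the line
    are the same function of [h]. *)
Lemma is_derive_line (V : normedModType R) (f : V -> R) (x v : V) (d : R) :
  is_derive (0 : R) (1 : R) (fun h => f (h *: v + x)) d -> is_derive x v f d.
Proof.
move=> [df <-]; split; first by apply/derivable1P.
rewrite /derive; set q1 := fun h => h^-1 *: _; set q2 := fun h => h^-1 *: _.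
suff -> : q1 = q2 by [].
by apply/funext => h; rewrite /q1 /q2 /= addr0 scale0r add0r [_%:A]mulr1.
Qed.

Lemma lipschitz1_le (f df : R -> R) :
  (forall t : R, is_derive t (1 : R) f (df t)) -> (forall t, `|df t| <= 1) ->
  forall a b, `|f a - f b| <= `|a - b|.
Proof.
move=> fdf df1 a b; wlog ba : a b / b <= a.
  move=> H; have [/H//|/ltW/H] := leP b a.
  by rewrite [X in X <= _]distrC [X in _ <= X]distrC.
have [|c _ ->] := MVT_segment ba (fun t _ => fdf t).
  apply: derivable_within_continuous => t _.
  by have [] := fdf t.
by rewrite normrM ler_piMl.
Qed.

(** Imaginary parts are also reached, since Im z = Re (- i z): one real-valued function serves both
    the electric and the magnetic field. *)
Definition wave c theta : R := complex.Re (expi theta * c).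

Lemma waveE c theta :
  wave c theta = cos theta * complex.Re c - sin theta * complex.Im c.
Proof. by case: c. Qed.

Lemma wave0 theta : wave 0 theta = 0.
Proof. by rewrite /wave mulr0. Qed.

Lemma wave_sum (J : finType) (c : J -> R[i]) theta :
  wave (\sum_j c j) theta = \sum_j wave (c j) theta.
Proof.
apply: (big_morph (wave^~ theta)); last exact: wave0.
by move=> [p q] [r s]; rewrite !waveE /=; ring.
Qed.

(* Stands in for the modulus: R-valued, and submultiplicative without square
   roots. *)
Definition norm1c c : R := `|complex.Re c| + `|complex.Im c|.

Lemma norm_wave_le c theta : `|wave c theta| <= norm1c c.
Proof.
rewrite waveE (le_trans (ler_normB _ _))// !normrM lerD// ler_piMl//.
  exact: cos_max.
exact: sin_max.
Qed.

Lemma wave_lipschitz c theta kappa h :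
  `|wave c (theta + h * kappa) - wave c theta| <= `|h| * (`|kappa| * norm1c c).
Proof.
rewrite !waveE; set A := complex.Re c; set B := complex.Im c.
have -> : cos (theta + h * kappa) * A - sin (theta + h * kappa) * B -
    (cos theta * A - sin theta * B) =
    (cos (theta + h * kappa) - cos theta) * A -
    (sin (theta + h * kappa) - sin theta) * B by ring.
have -> : `|h| * (`|kappa| * norm1c c) =
    `|theta + h * kappa - theta| * `|A| + `|theta + h * kappa - theta| * `|B|.
  by rewrite [theta + _]addrC addrK normrM -mulrDr mulrA.
rewrite (le_trans (ler_normB _ _))// !normrM lerD// ler_wpM2r//.
- apply: (lipschitz1_le (@is_derive_cos R)) => t; rewrite normrN; exact: sin_max.
- apply: (lipschitz1_le (@is_derive_sin R)) => t; exact: cos_max.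
Qed.

Lemma is_derive_wave c theta kappa :
  is_derive (0 : R) (1 : R) (fun h => wave c (theta + h * kappa))
    (kappa * wave ('i%C * c) theta).
Proof.
pose L := shift theta \o (kappa \*: (id : R -> R)).
have dL : is_derive (0 : R) (1 : R) L kappa.
  apply: (is_derive_eq (is_derive1_comp (is_derive_shift _ _ _) _)).
  by rewrite mul1r [_%:A]mulr1.
have L0 : L 0 = theta by rewrite /L /= scaler0 add0r.
have -> : (fun h => wave c (theta + h * kappa)) =
    complex.Re c \*: (cos \o L) - complex.Im c \*: (sin \o L).
  apply/funext => h; rewrite waveE /L !fctE /=.
  by rewrite -![_ *: _]/(_ * _) [kappa * h]mulrC [_ + theta]addrC; ring.
apply: is_derive_eq; rewrite L0 waveE.
by case: c => a b /=; rewrite -![_ *: _]/(_ * _); ring.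
Qed.

Lemma dot_line x v w h : dot (h *: v + x) w = dot x w + h * dot v w.
Proof. by rewrite /dot linearD linearZ /= mulmxDl -scalemxAl !mxE addrC. Qed.

Lemma dot_delta w i : dot (delta_mx i 0) w = w i 0.
Proof. by rewrite /dot trmx_delta -rowE mxE. Qed.

Section wave_series.
Variables (D : set 'cV[R]_3) (b : 'cV[R]_3 -> 'cV[R[i]]_3) (g : 'cV[R]_3 -> R).
Hypothesis bounded_g : bounded_sums (patch (fun=> 0) D g).
Hypothesis bounded_wg : bounded_sums (patch (fun=> 0) D (fun w => enorm w * g w)).
Hypothesis norm_b : forall w i, D w -> norm1c (b w i 0) <= g w.

Lemma coord_le_enorm w i : `|w i 0| <= enorm w.
Proof.
rewrite /enorm -sqrtr_sqr ler_wsqrtr// /dot mxE (bigD1 i)//= mxE -expr2 lerDl.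
by apply: sumr_ge0 => j _; rewrite mxE -expr2 sqr_ge0.
Qed.

(** [g] dominates the terms and, as |w_i| is at most |w|, [enorm w * g w] dominates the difference
    quotients. *)
Lemma is_derive_wave_series x i :
  is_derive x (delta_mx i 0 : 'cV[R]_3)
    (fun y => rsum D (fun w => wave (b w i 0) (dot y w)))
    (rsum D (fun w => w i 0 * wave ('i%C * b w i 0) (dot x w))).
Proof.
apply: is_derive_line; rewrite /rsum.
apply: (is_derive_sum (u := fun w h => patch (fun=> 0) D
  (fun w => wave (b w i 0) (dot (h *: delta_mx i 0 + x) w)) w)
  bounded_g bounded_wg) => [w h|w h|w].
- rewrite /patch; case: ifPn => [/set_mem Dw|_]; last by rewrite normr0.
  exact: le_trans (norm_wave_le _ _) (norm_b _ Dw).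
- rewrite /patch; case: ifPn => [/set_mem Dw|_]; last by rewrite subrr normr0 mulr0.
  rewrite !dot_line !dot_delta mul0r addr0.
  rewrite (le_trans (wave_lipschitz _ _ _ _))// ler_wpM2l// ler_pM//.
  + by rewrite addr_ge0.
  + exact: coord_le_enorm.
  + exact: norm_b.
- rewrite /patch; case: ifPn => [/set_mem Dw|_]; last exact: is_derive_cst.
  under eq_fun do rewrite dot_line dot_delta.
  exact: is_derive_wave.
Qed.

(** The three partial derivatives add up, inside the series, to waves with coefficient i (w . b_w),
    which is 0. The factor [kappa] allows for 1 / sqrt eps and 1 / sqrt mu. *)
Lemma div_wave_series (kappa : R) (G : 'cV[R]_3 -> 'cV[R]_3) x :
  (forall w, D w -> \sum_i (w i 0)%:C%C * b w i 0 = 0) ->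
  (forall y i, G y i 0 = kappa * rsum D (fun w => wave (b w i 0) (dot y w))) ->
  has_div G x /\ div G x = 0.
Proof.
move=> b_transverse Gb.
have dG i : is_derive x (delta_mx i 0 : 'cV[R]_3) (fun y => G y i 0)
    (kappa * rsum D (fun w => w i 0 * wave ('i%C * b w i 0) (dot x w))).
  have -> : (fun y => G y i 0) =
      kappa \*: (fun y => rsum D (fun w => wave (b w i 0) (dot y w))).
    by apply/funext => y; rewrite Gb.
  have := is_derive_wave_series x i; exact: is_deriveZ.
split=> [i|]; first by have [] := dG i.
rewrite /div; under eq_bigr => i _ do rewrite (@derive_val _ _ _ _ _ _ _ (dG i)).
rewrite -mulr_sumr /rsum.
rewrite (dominated_sum_sum (g := fun=> patch (fun=> 0) D (fun w => enorm w * g w)))//.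
  rewrite (_ : (fun w => _) = fun=> 0).
    rewrite (_ : summability.sum _ = 0) ?mulr0//; apply: cvg_lim => //.
    rewrite (_ : partial_sum _ = fun=> 0); first exact: cvg_cst.
    by apply/funext => A; rewrite partial_sumE big1.
  apply/funext => w; rewrite /patch; case: (boolP (w \in D)) => [/set_mem Dw|_]; last by rewrite big1.
  have := b_transverse w Dw.
  move=> /(congr1 (fun z => wave ('i%C * z) (dot x w))).
  rewrite mulr0 wave0 mulr_sumr wave_sum => b0; rewrite -[RHS]b0; apply: eq_bigr => i _.
  by rewrite !waveE; case: (b w i 0) => p q /=; ring.
move=> i w; rewrite /patch; case: ifPn => [/set_mem Dw|_]; last by rewrite normr0.
rewrite normrM ler_pM//; first exact: coord_le_enorm.
rewrite (le_trans (norm_wave_le _ _))// (le_trans _ (norm_b i Dw))//.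
(* Multiplication by i only exchanges |Re| and |Im|. *)
by rewrite /norm1c; case: (b w i 0) => p q /=; rewrite !mul0r !mul1r sub0r add0r normrN addrC.
Qed.

End wave_series.
End waves.

(** * Unitarity of the matrices V_w *)

Section basis.
Variable R : realType.
Implicit Types (w : 'cV[R]_3) (d e i : 'I_3).

Lemma sum3 (V : nmodType) (F : 'I_3 -> V) : \sum_i F i = F 0 + F 1 + F 2.
Proof.
rewrite !big_ord_recl big_ord0 addr0 addrA.
by congr (_ + F _ + F _); apply/val_inj.
Qed.

Lemma ord3_ind (P : 'I_3 -> Prop) : P 0 -> P 1 -> P 2 -> forall i, P i.
Proof.
move=> P0 P1 P2 [[|[|[|//]]] i3].
- by rewrite (_ : Ordinal i3 = 0)//; exact/val_inj.
- by rewrite (_ : Ordinal i3 = 1)//; exact/val_inj.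
- by rewrite (_ : Ordinal i3 = 2)//; exact/val_inj.
Qed.

Lemma conj_complexE (a b : R) : Num.conj (a +i* b)%C = (a -i* b)%C.
Proof. by []. Qed.

Lemma dotE (x w : 'cV[R]_3) :
  dot x w = x 0 0 * w 0 0 + x 1 0 * w 1 0 + x 2 0 * w 2 0.
Proof. by rewrite /dot mxE sum3 !mxE. Qed.

Lemma dot_ge0 w : 0 <= dot w w.
Proof. by rewrite dotE -!expr2 !addr_ge0 ?sqr_ge0. Qed.

Lemma sqr_enorm w : enorm w ^+ 2 = dot w w.
Proof. by rewrite sqr_sqrtr// dot_ge0. Qed.

Lemma enorm_gt0 w : w != 0 -> 0 < enorm w.
Proof.
move=> w0; rewrite sqrtr_gt0 lt_neqAle dot_ge0 andbT eq_sym.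
apply: contra w0; rewrite dotE -!expr2 !paddr_eq0 ?addr_ge0 ?sqr_ge0// !sqrf_eq0.
move=> /andP[/andP[/eqP w0 /eqP w1] /eqP w2].
by apply/eqP/matrixP => i j; rewrite ord1 mxE; elim/ord3_ind: i.
Qed.

Lemma rvecE w : [/\ rvec w 0 0 = w 1 0 - w 2 0, rvec w 1 0 = w 2 0 - w 0 0
  & rvec w 2 0 = w 0 0 - w 1 0].
Proof. by split; rewrite mxE. Qed.

Lemma complex_subr0 (s t : R) (c : R[i]) :
  s - complex.Re c = 0 -> t - complex.Im c = 0 -> (s +i* t)%C = c.
Proof. by case: c => c1 c2 /= /subr0_eq -> /subr0_eq ->. Qed.

Lemma vd0E w i : vd 0 w i 0 = ((enorm w)^-1 * w i 0 +i* 0)%C.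
Proof. by rewrite /vd /= !mxE. Qed.

Lemma inner3E (u v : 'I_3 -> R[i]) (p q p' q' : 'I_3 -> R) :
  (forall i, u i = (p i +i* q i)%C) -> (forall i, v i = (p' i +i* q' i)%C) ->
  \sum_i Num.conj (u i) * v i =
  ((\sum_i (p i * p' i + q i * q' i)) +i* (\sum_i (p i * q' i - q i * p' i)))%C.
Proof.
move=> up vp; rewrite !sum3 !up !vp !conj_complexE.
apply/eqP; rewrite eq_complex /=; apply/andP; split; apply/eqP; ring.
Qed.

(** Since [mud 0 w] is 0, one formula gives the imaginary part of all three columns. *)
Lemma vd_genericE d w i : rvec w != 0 ->
  vd d w i 0 =
  ((if d == 0 then (enorm w)^-1 * w i 0
    else (nu w)^-1 * (svec w / enorm w ^+ 2 * w i 0 - 1))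
   +i* (- ((nu w)^-1 * (mud d w / enorm w ^+ 2) * rvec w i 0)))%C.
Proof.
move=> r0; have [->|/negPf d0] := eqVneq d 0.
  by rewrite vd0E /mud /= mul0r mulr0 mul0r oppr0.
rewrite /vd d0 r0 !mxE.
by apply/eqP; rewrite eq_complex /=; apply/andP; split; apply/eqP; ring.
Qed.

Lemma vd_generic_inner w d e : w != 0 -> rvec w != 0 ->
  \sum_i Num.conj (vd d w i 0) * vd e w i 0 = (d == e)%:R.
Proof.
move=> w0 r0.
have N0 := enorm_gt0 w0.
have M0 := enorm_gt0 r0.
have H1 : (enorm w)^-1 ^+ 2 * dot w w = 1.
  by rewrite -sqr_enorm -exprMn mulVf ?expr1n// gt_eqF.
have H2 : 2 * (nu w)^-1 ^+ 2 * (enorm w)^-1 ^+ 2 * dot (rvec w) (rvec w) = 1.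
  rewrite -sqr_enorm /nu exprVn !exprMn sqr_sqrtr//.
  by field; rewrite !gt_eqF.
have mudE f : mud f w / enorm w ^+ 2 = [tuple 0; - (enorm w)^-1; (enorm w)^-1]`_f.
  by elim/ord3_ind: f; rewrite /mud /=; field; rewrite gt_eqF.
have Es : svec w / enorm w ^+ 2 = (w 0 0 + w 1 0 + w 2 0) * (enorm w)^-1 ^+ 2.
  by rewrite /svec sum3 exprVn.
rewrite (inner3E (fun i => vd_genericE d i r0) (fun i => vd_genericE e i r0)).
have [r1 r2 r3] := rvecE w.
move: H1 H2; rewrite !sum3 !dotE !r1 !r2 !r3 !Es !mudE.
(* From here 1/|w| and 1/nu are free variables [n] and [k], tied to the coordinates only by [H1] and
   [H2]. *)
move: (w 0 0) (w 1 0) (w 2 0) (enorm w)^-1 (nu w)^-1 => x y z n k H1 H2.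
have H1' : n ^+ 2 * (x * x + y * y + z * z) - 1 = 0 by rewrite H1 subrr.
have H2' : 2 * k ^+ 2 * n ^+ 2 * ((y - z) * (y - z) + (z - x) * (z - x) +
  (x - y) * (x - y)) - 1 = 0 by rewrite H2 subrr.
have comb (a b s : R) : s = a * (n ^+ 2 * (x * x + y * y + z * z) - 1) +
  b * (2 * k ^+ 2 * n ^+ 2 * ((y - z) * (y - z) + (z - x) * (z - x) +
  (x - y) * (x - y)) - 1) -> s = 0 by move=> ->; rewrite H1' H2' !mulr0 addr0.
pose s := x + y + z.
(* Every entry is a combination of [n^2 |w|^2 = 1] and [2 k^2 n^2 |r|^2 = 1],
   by the identity [|r|^2 = 3 |w|^2 - s^2]. *)
elim/ord3_ind: d; elim/ord3_ind: e; apply: complex_subr0.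
- apply: (comb 1 0); rewrite /= /s; ring.
- apply: (comb 0 0); rewrite /= /s; ring.
- apply: (comb (n * k * s) 0); rewrite /= /s; ring.
- apply: (comb 0 0); rewrite /= /s; ring.
- apply: (comb (n * k * s) 0); rewrite /= /s; ring.
- apply: (comb 0 0); rewrite /= /s; ring.
- apply: (comb (n * k * s) 0); rewrite /= /s; ring.
- apply: (comb 0 0); rewrite /= /s; ring.
- apply: (comb (k ^+ 2 * (s ^+ 2 * n ^+ 2 - 3)) 1); rewrite /= /s; ring.
- apply: (comb 0 0); rewrite /= /s; ring.
- apply: (comb (k ^+ 2 * (s ^+ 2 * n ^+ 2 - 3)) 0); rewrite /= /s; ring.
- apply: (comb 0 0); rewrite /= /s; ring.
- apply: (comb (n * k * s) 0); rewrite /= /s; ring.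
- apply: (comb 0 0); rewrite /= /s; ring.
- apply: (comb (k ^+ 2 * (s ^+ 2 * n ^+ 2 - 3)) 0); rewrite /= /s; ring.
- apply: (comb 0 0); rewrite /= /s; ring.
- apply: (comb (k ^+ 2 * (s ^+ 2 * n ^+ 2 - 3)) 1); rewrite /= /s; ring.
- apply: (comb 0 0); rewrite /= /s; ring.
Qed.
(** The imaginary part changes sign once for [d = 2] and once for a negative coordinate; the two
    conjugations combine as an exclusive or. *)
Lemma vd_diagE d w i : rvec w = 0 ->
  let h := (Num.sqrt 3)^-1 : R in
  vd d w i 0 =
  ((if d == 0 then (enorm w)^-1 * w i 0 else h * [tuple 1 / 2; 1 / 2; -1]`_i)
   +i* (if d == 0 then 0 else
    (-1) ^+ ((d == 2) (+) ~~ (0 <= w 0 0)) *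
    (h * [tuple Num.sqrt 3 / 2; - (Num.sqrt 3 / 2); 0]`_i)))%C.
Proof.
move=> r0 /=; have [->|/negPf d0] := eqVneq d 0; first by rewrite vd0E.
rewrite /vd d0 r0 eqxx /=.
elim/ord3_ind: d d0 => //= _; case: (0 <= w 0 0);
  elim/ord3_ind: i; rewrite !mxE /= ?conj_complexE;
  by apply/eqP; rewrite eq_complex /=; apply/andP; split; apply/eqP; ring.
Qed.

Lemma vd_diag_inner w d e : w != 0 -> rvec w = 0 ->
  \sum_i Num.conj (vd d w i 0) * vd e w i 0 = (d == e)%:R.
Proof.
move=> w0 r0.
have H1 : (enorm w)^-1 ^+ 2 * dot w w = 1.
  by rewrite -sqr_enorm -exprMn mulVf ?expr1n// gt_eqF ?enorm_gt0.
have t2 : Num.sqrt 3 ^+ 2 = 3 :> R by rewrite sqr_sqrtr.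
have h2 : (Num.sqrt 3)^-1 ^+ 2 = 1 / 3 :> R by rewrite exprVn t2 div1r.
have [r1 r2 r3] := rvecE w.
rewrite (inner3E (fun i => vd_diagE d i r0) (fun i => vd_diagE e i r0)) !sum3.
move: r1 r2 r3; rewrite r0 !mxE.
move=> /esym/eqP; rewrite subr_eq0 => /eqP w12 /esym/eqP; rewrite subr_eq0 => /eqP w20 _.
move: H1; rewrite dotE w12 w20.
set b := 0 <= w 0 0.
move: b (w 0 0) (enorm w)^-1 => b x n H1.
move: (Num.sqrt 3) t2 h2 => t t2; move: t^-1 => h h2.
have comb (p q r s : R) : s = p * (n ^+ 2 * (x * x + x * x + x * x) - 1) +
    q * (t ^+ 2 - 3) + r * (h ^+ 2 - 1 / 3) -> s = 0.
  by move=> ->; rewrite H1 t2 h2 !subrr !mulr0 !addr0.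
elim/ord3_ind: d; elim/ord3_ind: e; apply: complex_subr0; case: b.
(* In order: the norm of column 0; the entries that vanish identically; the norms of columns 1 and
   2; the real part of their mutual product. *)
all: rewrite /= ?expr0 ?expr1; first
  [ apply: (comb 1 0 0); by field
  | apply: (comb 0 0 0); by field
  | apply: (comb 0 (h ^+ 2 / 2) 3); by field
  | apply: (comb 0 (- (h ^+ 2 / 2)) 0); by field ].
Qed.

Lemma vd_inner w d e : w != 0 ->
  \sum_i Num.conj (vd d w i 0) * vd e w i 0 = (d == e)%:R.
Proof.
move=> w0; have [r0|r0] := eqVneq (rvec w) 0; first exact: vd_diag_inner.
exact: vd_generic_inner.
Qed.

Lemma Vmx_unitary w : w != 0 -> (Vmx w)^t* *m Vmx w = 1%:M.
Proof.
move=> w0; apply/matrixP => d e; rewrite !mxE -(vd_inner d e w0).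
by apply: eq_bigr => i _; rewrite !mxE.
Qed.

(** The left side is V V^* a, and for square matrices V^* V = 1 gives V V^* = 1. *)
Lemma alpha_decomposition (a : 'cV[R]_3 -> 'cV[R[i]]_3) w : w != 0 ->
  \sum_d alpha a d w *: vd d w = a w.
Proof.
move=> w0; rewrite -[RHS]mul1mx -(mulmx1C (Vmx_unitary w0)) -mulmxA.
apply/matrixP => i j; rewrite ord1 summxE [RHS]mxE.
by apply: eq_bigr => d _; rewrite mxE [Vmx w i d]mxE mulrC.
Qed.

(** Column 0 is the real vector w / |w|, so this is orthogonality of columns up to the factor
    |w|. *)
Lemma vd_transverse w d : w != 0 -> d != 0 ->
  \sum_i (w i 0)%:C%C * vd d w i 0 = 0.
Proof.
move=> w0 /negPf d0; have N0 := enorm_gt0 w0.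
have := vd_inner 0 d w0; rewrite eq_sym d0 => H.
apply: (mulfI (_ : ((enorm w)^-1)%:C%C != 0)).
  by rewrite eq_complex /= negb_and invr_eq0 gt_eqF.
rewrite mulr0 -[RHS]H mulr_sumr; apply: eq_bigr => i _.
rewrite vd0E conj_complexE mulrA; congr (_ * _).
by apply/eqP; rewrite eq_complex /=; apply/andP; split; apply/eqP; ring.
Qed.

(** * Bounds on the columns and the coefficients in [norm1c] *)

Lemma norm1c_ge0 (z : R[i]) : 0 <= norm1c z.
Proof. by rewrite addr_ge0. Qed.

Lemma norm1cD (z z' : R[i]) : norm1c (z + z') <= norm1c z + norm1c z'.
Proof.
case: z z' => a b [c d]; rewrite /norm1c /= addrACA.
by rewrite lerD// ler_normD.
Qed.

Lemma norm1cN (z : R[i]) : norm1c (- z) = norm1c z.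
Proof. by case: z => a b; rewrite /norm1c /= !normrN. Qed.

Lemma norm1cM (z z' : R[i]) : norm1c (z * z') <= norm1c z * norm1c z'.
Proof.
case: z z' => a b [c d]; rewrite /norm1c /=.
rewrite (le_trans (lerD (ler_normB _ _) (ler_normD _ _)))// !normrM.
by rewrite le_eqVlt; apply/orP; left; apply/eqP; ring.
Qed.

Lemma norm1c_sum (z : 'I_3 -> R[i]) : norm1c (\sum_i z i) <= \sum_i norm1c (z i).
Proof.
elim/big_ind2: _ => //; first by rewrite /norm1c /= !normr0 addr0.
by move=> x1 x2 y1 y2 h1 h2; rewrite (le_trans (norm1cD _ _))// lerD.
Qed.

Lemma norm1c_conj (z : R[i]) : norm1c (Num.conj z) = norm1c z.
Proof. by case: z => a b; rewrite conj_complexE /norm1c /= normrN. Qed.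

Lemma norm1c_expi (t : R) : norm1c (expi t) <= 2.
Proof. by rewrite -[2]/(1 + 1) lerD// ?cos_max ?sin_max. Qed.

Lemma norm1c_le (z : R[i]) (m : R) : 0 <= m ->
  complex.Re z ^+ 2 + complex.Im z ^+ 2 <= m ^+ 2 -> norm1c z <= 2 * m.
Proof.
case: z => a b /= m0 abm; rewrite mulr_natl mulr2n lerD//.
  by rewrite -ler_sqr ?nnegrE// real_normK ?num_real// (le_trans _ abm)// lerDl sqr_ge0.
by rewrite -ler_sqr ?nnegrE// real_normK ?num_real// (le_trans _ abm)// lerDr sqr_ge0.
Qed.

(** Columns are unit vectors, so each entry has modulus at most 1. *)
Lemma norm1c_vd w d i : w != 0 -> norm1c (vd d w i 0) <= 2.
Proof.
move=> w0; rewrite -[2]mulr1; apply: norm1c_le => //; rewrite expr1n.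
have -> : 1 = \sum_j (complex.Re (vd d w j 0) ^+ 2 + complex.Im (vd d w j 0) ^+ 2).
  have := vd_inner d d w0; rewrite eqxx => /(congr1 (@complex.Re R)) /= <-.
  rewrite !sum3; case: (vd d w 0 0) (vd d w 1 0) (vd d w 2 0) => [p q] [p1 q1] [p2 q2].
  by rewrite !conj_complexE /=; ring.
by rewrite (bigD1 i)//= lerDl sumr_ge0// => j _; rewrite addr_ge0 ?sqr_ge0.
Qed.

Lemma norm1c_cnorm (a : 'cV[R[i]]_3) i : norm1c (a i 0) <= 2 * cnorm a.
Proof.
apply: norm1c_le; first exact: sqrtr_ge0.
have s0 : 0 <= \sum_j (complex.Re (a j 0) ^+ 2 + complex.Im (a j 0) ^+ 2).
  by apply: sumr_ge0 => j _; rewrite addr_ge0 ?sqr_ge0.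
rewrite sqr_sqrtr// (bigD1 i)//= lerDl.
by apply: sumr_ge0 => j _; rewrite addr_ge0 ?sqr_ge0.
Qed.

Lemma norm1c_alpha (a : 'cV[R]_3 -> 'cV[R[i]]_3) d w : w != 0 ->
  norm1c (alpha a d w) <= 12 * cnorm (a w).
Proof.
move=> w0; rewrite /alpha mxE (le_trans (norm1c_sum _))//.
(* Three products, each of a matrix entry (at most 2) and an entry of [a w] (at most
   [2 * cnorm (a w)]). *)
have -> : 12 * cnorm (a w) = \sum_(i < 3) 2 * (2 * cnorm (a w)).
  by rewrite sum3; ring.
apply: ler_sum => i _; rewrite (le_trans (norm1cM _ _))//.
rewrite !mxE norm1c_conj ler_pM ?norm1c_ge0// ?norm1c_vd//.
exact: norm1c_cnorm.
Qed.

End basis.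

(** * The difference of the two Fourier series *)

(** Passes from extended real sums to real ones: each finite partial sum is among those whose
    supremum is the [esum]. *)
Lemma esum_bounded_sums (R : realType) (I : choiceType) (D : set I) (g : I -> R) :
  (forall i, 0 <= g i) -> (\esum_(i in D) (g i)%:E < +oo)%E ->
  bounded_sums (patch (fun=> 0) D g).
Proof.
move=> g0 gD.
have sum0 : (0 <= \esum_(i in D) (g i)%:E)%E.
  by apply: esum_ge0 => i _; rewrite lee_fin.
exists (fine (\esum_(i in D) (g i)%:E)) => _ [A _ <-].
rewrite -lee_fin fineK ?ge0_fin_numE// esum_mkcond partial_sumE -sumEFin.
apply: ereal_sup_ubound; exists [set` A]; first by split.
rewrite fsbig_finite//= set_fsetK; apply: eq_bigr => i _.
by rewrite /patch; case: ifP.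
Qed.

(** As P is invertible, some coordinate of P^T w is nonzero. It lies in 2 pi Z, so its modulus is at
    least 1, while it is at most M |w|. *)
Lemma wave_vectors_enorm_ge (R : realType) (P : 'M[R]_3) : P \in unitmx ->
  exists M : R, 0 <= M /\ forall w, wave_vectors P w -> 1 <= M * enorm w.
Proof.
(* Summing over all entries of [P] makes the bound independent of which coordinate is nonzero. *)
move=> Pu; exists (\sum_j \sum_i `|P i j|); split.
  by apply: sumr_ge0 => j _; apply: sumr_ge0.
move=> w [w0 wP].
have [j Pwj] : exists j, (P^T *m w) j 0 != 0.
  apply/existsP; apply: contraNT w0 => /existsPn Pw0; apply/eqP.
  rewrite -[w]mul1mx -(mulVmx (_ : P^T \in unitmx)) ?unitmx_tr// -mulmxA.
  rewrite (_ : P^T *m w = 0) ?mulmx0//; apply/matrixP => j k.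
  by rewrite ord1 [RHS]mxE; apply/eqP; have := Pw0 j; rewrite negbK.
have [m] := wP (delta_mx j 0).
have -> : dot (period P (delta_mx j 0)) w = (P^T *m w) j 0.
  by rewrite /dot /period map_delta_mx trmx_mul trmx_delta -mulmxA -rowE mxE.
move=> Pwm.
have m1 : 1 <= `|(m%:~R : R)|.
  rewrite -intr_norm -[1]/(1%:~R) ler_int -gtz0_ge1 normr_gt0.
  by apply: contra Pwj => /eqP m0; rewrite Pwm m0 mulr0.
have Pw1 : 1 <= `|(P^T *m w) j 0|.
  have pi2 : 1 <= 2 * pi :> R by have := pi_ge2 R; lra.
  by rewrite Pwm normrM mulr_ege1// (le_trans pi2)// ler_norm.
rewrite (le_trans Pw1)// mxE (le_trans (ler_norm_sum _ _ _))//.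
rewrite [X in _ <= X * _](bigD1 j)//= mulrDl mulr_suml -[leLHS]addr0 lerD//.
  by apply: ler_sum => i _; rewrite mxE normrM ler_wpM2l// coord_le_enorm.
rewrite mulr_ge0 ?sqrtr_ge0//.
by apply: sumr_ge0 => k _; apply: sumr_ge0.
Qed.

Lemma eq_rsum (R : realType) (D : set 'cV[R]_3) (f h : 'cV[R]_3 -> R) :
  (forall w, D w -> f w = h w) -> rsum D f = rsum D h.
Proof.
move=> fh; rewrite /rsum; congr summability.sum; apply/funext => w.
by rewrite /patch; case: ifPn => // /set_mem; exact: fh.
Qed.

Section maxwell.
Variable R : realType.
Implicit Types (a : 'cV[R]_3 -> 'cV[R[i]]_3) (phi : 'I_3 -> 'cV[R]_3 -> R) (w : 'cV[R]_3).

Definition phase_increment a phi w : 'cV[R[i]]_3 :=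
  \sum_d ((expi (phi d w) - 1) * alpha a d w) *: vd d w.

(** Write e^{i phi} = 1 + (e^{i phi} - 1); the terms with 1 reassemble to [a w] by unitarity. *)
Lemma phase_incrementE a phi w i theta : w != 0 ->
  (\sum_d (expi (phi d w) * alpha a d w * expi theta) *: vd d w) i 0 =
  expi theta * a w i 0 + expi theta * phase_increment a phi w i 0.
Proof.
move=> w0; rewrite -(alpha_decomposition a w0) /phase_increment -mulrDr !summxE.
rewrite -big_split mulr_sumr; apply: eq_bigr => d _ /=.
by rewrite !mxE; ring.
Qed.

Lemma phase_increment_transverse a phi w : w != 0 -> phi 0 w = 0 ->
  \sum_i (w i 0)%:C%C * phase_increment a phi w i 0 = 0.
Proof.
move=> w0 phi0; under eq_bigr => i _ do rewrite /phase_increment summxE mulr_sumr.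
rewrite exchange_big big1//= => d _.
have [->|d0] := eqVneq d 0.
  rewrite big1// => i _; rewrite phi0 mxE /expi cos0 sin0.
  by rewrite -[(1 +i* 0)%C]/(1 : R[i]) subrr !mul0r mulr0.
have := vd_transverse w0 d0; move/(congr1 (fun z => (expi (phi d w) - 1) * alpha a d w * z)).
rewrite mulr0 mulr_sumr => {2}<-; apply: eq_bigr => i _.
by rewrite mxE; ring.
Qed.

Lemma norm1c_phase_increment a phi w i : w != 0 ->
  norm1c (phase_increment a phi w i 0) <= 216 * cnorm (a w).
Proof.
move=> w0; rewrite /phase_increment summxE (le_trans (norm1c_sum _))//.
(* Three columns; in each, 3 bounds e^{i phi} - 1, 12 |a_w| bounds [alpha] and 2 bounds the column
   entry. *)
have -> : 216 * cnorm (a w) = \sum_(d < 3) 3 * (12 * cnorm (a w)) * 2.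
  by rewrite sum3; ring.
apply: ler_sum => d _; rewrite mxE (le_trans (norm1cM _ _))//.
rewrite ler_pM ?norm1c_ge0// ?norm1c_vd// (le_trans (norm1cM _ _))//.
rewrite ler_pM ?norm1c_ge0// ?norm1c_alpha// (le_trans (norm1cD _ _))//.
have -> : (3 : R) = 2 + 1 by ring.
by rewrite lerD ?norm1c_expi// norm1cN /norm1c /= normr0 normr1 addr0.
Qed.

End maxwell.

Theorem corollary2p8 (R : realType) (eps mu : R) (eps_gt0 : 0 < eps)
  (mu_gt0 : 0 < mu)
  (E0 H0 : 'cV[R]_3 -> 'cV[R]_3)
  (P : 'M[R]_3) (P_unit : P \in unitmx)
  (F0_periodic : forall (x : 'cV[R]_3) (k : 'cV[int]_3),
     em_vector eps mu (E0 (x + period P k)) (H0 (x + period P k))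
     = em_vector eps mu (E0 x) (H0 x))
  (f0 : 'cV[R[i]]_3) (a : 'cV[R]_3 -> 'cV[R[i]]_3)
  (a_summable :
     (\esum_(w in wave_vectors P) (enorm w * cnorm (a w))%:E < +oo)%E)
  (F0_fourier : forall x : 'cV[R]_3,
     em_vector eps mu (E0 x) (H0 x)
     = f0 + vsum (wave_vectors P) (fun w => expi (dot x w) *: a w))
  (E H : 'cV[R]_3 -> R -> 'cV[R]_3)
  (EH_formula : forall (x : 'cV[R]_3) (t : R),
     em_vector eps mu (E x t) (H x t)
     = f0 + vsum (wave_vectors P) (fun w =>
         \sum_(d < 3) (expi (- (t * mud d w) / Num.sqrt (mu * eps))
                       * alpha a d w * expi (dot x w)) *: vd d w)) :
  forall (x : 'cV[R]_3) (t : R),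
    (has_div (fun y => E y t - E0 y) x /\ div (fun y => E y t - E0 y) x = 0) /\
    (has_div (fun y => H y t - H0 y) x /\ div (fun y => H y t - H0 y) x = 0).
Proof.
move=> x t.
set D := wave_vectors P in a_summable F0_fourier EH_formula *.
pose phi (d : 'I_3) (w : 'cV[R]_3) := - (t * mud d w) / Num.sqrt (mu * eps).
pose b := phase_increment a phi.
have Dn0 w : D w -> w != 0 by case.
have [M [M0 DM]] := wave_vectors_enorm_ge P_unit.
have cn0 w : 0 <= cnorm (a w) by exact: sqrtr_ge0.
have bwg : bounded_sums (patch (fun=> 0) D (fun w => enorm w * cnorm (a w))).
  by apply: esum_bounded_sums => // w; rewrite mulr_ge0// sqrtr_ge0.
(* On wave vectors 1 <= M |w|, so |a_w| is at most M |w| |a_w|. *)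
have bg : bounded_sums (patch (fun=> 0) D (fun w => cnorm (a w))).
  have [K MK] := bounded_sumsZ M0 bwg; exists K => _ [A _ <-].
  apply: le_trans (MK _ (ex_intro2 _ _ A I erefl)); rewrite !partial_sumE.
  apply: ler_sum => w _; rewrite /patch; case: ifPn => [/set_mem Dw|_]; last by rewrite mulr0.
  by rewrite mulrA ler_peMl// DM.
(* A common majorant for the entries of [a w] and [b w]. *)
pose g w := 216 * cnorm (a w).
have patchZ (k : R) (h : 'cV[R]_3 -> R) : bounded_sums (patch (fun=> 0) D h) -> 0 <= k ->
    bounded_sums (patch (fun=> 0) D (fun w => k * h w)).
  move=> bh k0; have := bounded_sumsZ k0 bh; congr bounded_sums.
  by apply/funext => w; rewrite /patch; case: ifP; rewrite ?mulr0.
have bg216 : bounded_sums (patch (fun=> 0) D g) by exact: patchZ.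
have bwg216 : bounded_sums (patch (fun=> 0) D (fun w => enorm w * g w)).
  have := patchZ 216 _ bwg (ler0n _ _); congr (bounded_sums (patch _ _ _)).
  by apply/funext => w; rewrite mulrCA.
have a_le w i : norm1c (a w i 0) <= g w.
  by rewrite (le_trans (norm1c_cnorm _ _))// ler_wpM2r// ler_nat.
have b_le w i : D w -> norm1c (b w i 0) <= g w.
  by move=> /Dn0 w0; exact: norm1c_phase_increment.
have b_trans w : D w -> \sum_i (w i 0)%:C%C * b w i 0 = 0.
  move=> /Dn0 w0; apply: phase_increment_transverse => //.
  by rewrite /phi /mud /= mulr0 oppr0 mul0r.
(* Used with c = 1 for real parts and c = - i for imaginary parts. Subtracting the series requires
   both to converge, which the majorants [2 * g] and [g] ensure. *)
have rsumB (c : R[i]) y i : norm1c c <= 1 ->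
    rsum D (fun w => wave (c * (a w i 0 + b w i 0)) (dot y w)) -
    rsum D (fun w => wave (c * a w i 0) (dot y w)) =
    rsum D (fun w => wave (c * b w i 0) (dot y w)).
  move=> c1.
  have cz (z : R[i]) : norm1c (c * z) <= norm1c z.
    by rewrite (le_trans (norm1cM _ _))// ler_piMl ?norm1c_ge0.
  have gg : bounded_sums (patch (fun=> 0) D (fun w => 2 * g w)) by exact: patchZ.
  rewrite /rsum -(dominated_sumB (g1 := patch (fun=> 0) D (fun w => 2 * g w))
    (g2 := patch (fun=> 0) D g))//.
  - congr summability.sum; apply/funext => w; rewrite /patch; case: ifP => _; last exact: subrr.
    by rewrite !waveE; case: c {c1 cz} (a w i 0) (b w i 0) => p q [r s] [u v] /=; ring.
  - move=> w; rewrite /patch; case: ifPn => [/set_mem Dw|_]; last by rewrite normr0.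
    rewrite (le_trans (norm_wave_le _ _))// (le_trans (cz _))// (le_trans (norm1cD _ _))//.
    by rewrite mulr_natl mulr2n lerD ?a_le ?b_le.
  - move=> w; rewrite /patch; case: ifPn => [/set_mem Dw|_]; last by rewrite normr0.
    by rewrite (le_trans (norm_wave_le _ _))// (le_trans (cz _))// a_le.
(* The constant [f0] cancels, leaving the series with coefficients [b w]. *)
have EHb y i : em_vector eps mu (E y t) (H y t) i 0 - em_vector eps mu (E0 y) (H0 y) i 0 =
    (rsum D (fun w => wave (b w i 0) (dot y w)) +i*
     rsum D (fun w => wave (- 'i%C * b w i 0) (dot y w)))%C.
  rewrite EH_formula F0_fourier ![(f0 + _) i 0]mxE opprD addrACA subrr add0r !mxE.
  apply/eqP; rewrite eq_complex /=; apply/andP; split; apply/eqP.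
    have := rsumB 1 y i; rewrite /norm1c /= normr0 normr1 addr0 => /(_ (lexx _)).
    under [X in _ = X]eq_rsum => w _ do rewrite mul1r.
    move=> <-; congr (_ - _); apply: eq_rsum => w Dw; last by rewrite mxE /wave mul1r.
    by rewrite (phase_incrementE a phi) ?Dn0// -mulrDr mul1r.
  have := rsumB (- 'i%C) y i; rewrite norm1cN /norm1c /= normr0 normr1 add0r => /(_ (lexx _)) <-.
  congr (_ - _); apply: eq_rsum => w Dw; last first.
    by rewrite mxE waveE /expi; case: (a w i 0) => p q /=; ring.
  rewrite (phase_incrementE a phi) ?Dn0// -mulrDr -/(b w) waveE /expi.
  by case: (_ + _) => p q /=; ring.
have em_sub y i : em_vector eps mu (E y t) (H y t) i 0 - em_vector eps mu (E0 y) (H0 y) i 0 =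
    (Num.sqrt eps * (E y t - E0 y) i 0 +i* (Num.sqrt mu * (H y t - H0 y) i 0))%C.
  by rewrite !mxE; apply/eqP; rewrite eq_complex /=; apply/andP; split; apply/eqP; ring.
have seps : Num.sqrt eps != 0 by rewrite gt_eqF// sqrtr_gt0.
have smu : Num.sqrt mu != 0 by rewrite gt_eqF// sqrtr_gt0.
split.
  apply: (div_wave_series bg216 bwg216 b_le (kappa := (Num.sqrt eps)^-1)) => // y i.
  have := EHb y i; rewrite em_sub => -[<- _].
  by rewrite mulKf.
(* The magnetic part is the imaginary part, hence the coefficients - i b_w, which keep the bound and
   the transversality of b_w. *)
apply: (div_wave_series (b := fun w => - 'i%C *: b w) bg216 bwg216 _ (kappa := (Num.sqrt mu)^-1)).
- move=> w i Dw; rewrite mxE (le_trans (norm1cM _ _))// -[leRHS]mul1r ler_pM ?norm1c_ge0// ?b_le//.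
  by rewrite norm1cN /norm1c /= normr0 normr1 add0r.
- move=> w Dw; have := congr1 (fun z => - 'i%C * z) (b_trans w Dw).
  rewrite mulr0 mulr_sumr => b0; rewrite -[RHS]b0.
  by apply: eq_bigr => i _; rewrite mxE mulrCA.
- move=> y i; have := EHb y i; rewrite em_sub => -[_ e].
  under eq_fun do rewrite mxE.
  by rewrite -e mulKf.
Qed.
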